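(* Let $r\geq 1$ be an integer, let $e=\infty$, let $\mathbf{a}=(a_1,\dots,a_r)\in\mathbb{Z}^r$, and let $\Theta=\Theta(\infty;\mathbf{a})$ be the $(\infty;\mathbf{a})$-hub of the empty multipartition. Let $\theta$ be an $\infty$-hub. Then there exists an $(\infty;\mathbf{a})$-block with hub $\theta$ if and only if $v(\Theta)\stackrel{0,r}{\mapsto}v(\theta)$, and if this is the case then the unique such block has weight $\operatorname{ht}(v(\theta)-v(\Theta))$.
   Context: Multipartitions. A multipartition is an $r$-tuple $\boldsymbol{\lambda}=(\lambda^{(1)},\dots,\lambda^{(r)})$ of partitions, identified with its Young diagram $\{(i,j)_k : i,j\geq 1,\ 1\leq k\leq r,\ j\leq\lambda^{(k)}_i\}$, whose elements are called nodes. A node of $\boldsymbol{\lambda}$ is removable if deleting it leaves the Young diagram of a multipartition; a node not in $\boldsymbol{\lambda}$ is addable if adding it gives the Young diagram of a multipartition. Residues and blocks ($e=\infty$). The residue of $(i,j)_k$ is the integer $j-i+a_k$; a node of residue $l$ is an $l$-node. For $l\in\mathbb{Z}$, $c_l(\boldsymbol{\lambda})$ is the number of $l$-nodes of $\boldsymbol{\lambda}$; the content of $\boldsymbol\lambda$ is $(c_l(\boldsymbol\lambda))_{l\in\mathbb{Z}}$. An $(\infty;\mathbf{a})$-block is an equivalence class of multipartitions under the relation of having the same content. Hub and weight. An $\infty$-hub is a tuple $\theta=(\theta_i)_{i\in\mathbb{Z}}$ of integers, only finitely many non-zero, with $\sum_i\theta_i=-r$. The hub of $\boldsymbol\lambda$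 is $(\theta_i(\boldsymbol\lambda))_{i\in\mathbb{Z}}$, where $\theta_i(\boldsymbol\lambda)$ is the number of removable $i$-nodes minus the number of addable $i$-nodes of $\boldsymbol\lambda$. The weight of $\boldsymbol\lambda$ is $$w(\boldsymbol\lambda)=\sum_{j=1}^r c_{a_j}(\boldsymbol\lambda)-\tfrac12\sum_{i\in\mathbb{Z}}(c_i(\boldsymbol\lambda)-c_{i-1}(\boldsymbol\lambda))^2.$$ All multipartitions in a block have the same hub and the same weight, called the hub and weight of the block. It is known that for $e=\infty$ a block is uniquely determined by its hub. $\Theta$ is given by $\Theta_i=-|\{j\in\{1,\dots,r\}: a_j=i\}|$. The vector $v(\theta)$. For an $\infty$-hub $\theta$ and $i\in\mathbb{Z}$ put $d_i=r+\sum_{l\leq i}\theta_l$. For $1\leq j\leq r-1$ put $v_j(\theta)=|\{i\in\mathbb{Z}: d_i=j\}|$, and put $$v_0(\theta)=|\{i<0: d_i=0\}|-|\{i\geq0: d_i\neq0\}|,\qquad v_r(\theta)=|\{i\geq0: d_i=r\}|-|\{i<0: d_i\neq r\}|.$$ Then $v(\theta)=(v_0(\theta),\dots,v_r(\theta))\in\mathbb{Z}^{\{0,\dots,r\}}$. The relation $\stackrel{0,r}{\mapsto}$. For $1\leq i\leq r-1$ let $\alpha_i\in\mathbb{Z}^{\{0,\dots,r\}}$ be given by $(\alpha_i)_j=-\delta_{(i-1)j}+2\delta_{ij}-\delta_{(i+1)j}$, with $\delta$ the Kronecker delta. For $x,y\in\mathbb{Z}^{\{0,\dots,r\}}$, $x\stackrel{0,r}{\mapsto}y$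 means $y-x=\sum_{i=1}^{r-1}m_i\alpha_i$ with all $m_i$ non-negative integers; the $m_i$ are then unique and $\operatorname{ht}(y-x)=\sum_{i=1}^{r-1}m_i$. *)

(* Defs.v *)
From mathcomp Require Import all_boot all_order all_algebra finmap.
From mathcomp Require Import zify ring.
From mathcomp Require Import boolp classical_sets functions cardinality fsbigop.

Set Implicit Arguments.
Unset Strict Implicit.
Unset Printing Implicit Defensive.

Import Order.TTheory GRing.Theory Num.Theory.
Local Open Scope classical_set_scope.
Local Open Scope ring_scope.

(* [fset_set] sends an infinite set to the empty one, so [ncard] is only
   meaningful on finite sets; every set counted below is finite. *)
Definition ncard (T : choiceType) (A : set T) : nat := (#|` fset_set A|)%fset.

Definition intpart : Type := {s : seq nat | sorted geq s && (0%N \notin s)}.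

Definition empty_part : intpart := exist _ [::] isT.

Definition multipartition (r : nat) : Type := {ffun 'I_r -> intpart}.

Definition empty_mpart (r : nat) : multipartition r := [ffun=> empty_part].

(* Rows, columns and components are numbered from 0: the triple (i, j, k)
   stands for the node (i+1, j+1)_(k+1), which leaves residues unchanged. *)
Definition node (r : nat) : Type := (nat * nat * 'I_r)%type.

Definition diagram r (lam : multipartition r) : set (node r) :=
  [set n | (n.1.2 < nth 0 (val (lam n.2)) n.1.1)%N].

Definition removable r (lam : multipartition r) : set (node r) :=
  [set n | diagram lam n /\
           exists mu : multipartition r, diagram mu = diagram lam `\ n].

Definition addable r (lam : multipartition r) : set (node r) :=
  [set n | ~ diagram lam n /\
           exists mu : multipartition r, diagram mu = n |` diagram lam].

Definition residue r (a : 'I_r -> int) (n : node r) : int :=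
  n.1.2%:Z - n.1.1%:Z + a n.2.

Definition content r (a : 'I_r -> int) (lam : multipartition r) (l : int) : nat :=
  ncard (diagram lam `&` [set n | residue a n = l]).

Definition is_block r (a : 'I_r -> int) (B : set (multipartition r)) : Prop :=
  exists lam, B = [set mu | content a mu =1 content a lam].

Definition is_hub (r : nat) (theta : int -> int) : Prop :=
  finite_set [set i | theta i != 0] /\
  \sum_(i \in [set: int]) theta i = - r%:Z.

Definition hub r (a : 'I_r -> int) (lam : multipartition r) (i : int) : int :=
  (ncard (removable lam `&` [set n | residue a n = i]))%:Z
  - (ncard (addable lam `&` [set n | residue a n = i]))%:Z.

Definition weight r (a : 'I_r -> int) (lam : multipartition r) : rat :=
  \sum_(j < r) (content a lam (a j))%:R
  - 2^-1 * \sum_(i \in [set: int])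
      ((content a lam i)%:R - (content a lam (i - 1))%:R : rat) ^+ 2.

Definition block_has_hub r (a : 'I_r -> int) (B : set (multipartition r))
    (theta : int -> int) : Prop :=
  forall lam, B lam -> hub a lam =1 theta.

Definition block_has_weight r (a : 'I_r -> int) (B : set (multipartition r))
    (w : rat) : Prop :=
  forall lam, B lam -> weight a lam = w.

Definition dsum (r : nat) (theta : int -> int) (i : int) : int :=
  r%:Z + \sum_(l \in [set l : int | l <= i]) theta l.

Definition v0 (r : nat) (theta : int -> int) : int :=
  (ncard [set i : int | i < 0 /\ dsum r theta i = 0])%:Z
  - (ncard [set i : int | 0 <= i /\ dsum r theta i <> 0])%:Z.

Definition vr (r : nat) (theta : int -> int) : int :=
  (ncard [set i : int | 0 <= i /\ dsum r theta i = r%:Z])%:Z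
  - (ncard [set i : int | i < 0 /\ dsum r theta i <> r%:Z])%:Z.

(* Vectors of Z^{0,...,r} are row vectors of length r.+1. *)
Definition v (r : nat) (theta : int -> int) : 'rV[int]_r.+1 :=
  \row_(j < r.+1)
    if j == 0%N :> nat then v0 r theta
    else if j == r :> nat then vr r theta
    else (ncard [set i : int | dsum r theta i = j%:Z])%:Z.

(* Only used for 0 < i < r. *)
Definition alpha (r i : nat) : 'rV[int]_r.+1 :=
  \row_(j < r.+1)
    (- (i.-1 == j)%:R + 2 * (i == j)%:R - (i.+1 == j)%:R).

Definition mapsto0r r (x y : 'rV[int]_r.+1) : Prop :=
  exists m : nat -> nat, y - x = \sum_(1 <= i < r) alpha r i *+ m i.

(* Lemma [htE] below shows that this does not depend on the decomposition. *)
Definition ht r (z : 'rV[int]_r.+1) : nat :=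
  xget 0%N [set h | exists2 m : nat -> nat,
    z = \sum_(1 <= i < r) alpha r i *+ m i & h = (\sum_(1 <= i < r) m i)%N].

Lemma alpha_moment r i : (0 < i < r)%N ->
  \sum_(j < r.+1) (j%:Z ^+ 2) * alpha r i 0 j = - 2.
Proof.
case/andP=> i0 ir.
have pick (k : nat) : (k < r.+1)%N ->
    \sum_(j < r.+1) (j%:Z ^+ 2) * (k == j)%:R = k%:Z ^+ 2.
  move=> kr; rewrite (bigD1 (Ordinal kr)) //= eqxx mulr1 big1 ?addr0 // => j.
  by rewrite -val_eqE /= eq_sym => /negPf->; rewrite mulr0.
under eq_bigr do rewrite mxE mulrBr mulrDr mulrN mulrCA.
rewrite big_split big_split /= !sumrN -mulr_sumr !pick ?ltnS //; last first.
- by rewrite (leq_trans (leq_pred _)) // ltnW.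
- exact: ltnW.
case: i i0 {ir} => //= i _.
have e1 : (i.+1)%:Z = i%:Z + 1 by lia.
have e2 : (i.+2)%:Z = i%:Z + 2 by lia.
by rewrite e1 e2; ring.
Qed.

Lemma htE r (m : nat -> nat) :
  ht (\sum_(1 <= i < r) alpha r i *+ m i) = (\sum_(1 <= i < r) m i)%N.
Proof.
pose phi (z : 'rV[int]_r.+1) : int := \sum_(j < r.+1) (j%:Z ^+ 2) * z 0 j.
have phiE (m' : nat -> nat) :
    phi (\sum_(1 <= i < r) alpha r i *+ m' i)
    = - 2 * (\sum_(1 <= i < r) m' i)%N%:Z.
  rewrite /phi; under [LHS]eq_bigr do rewrite summxE mulr_sumr.
  rewrite exchange_big /= -natz natr_sum mulr_sumr; apply: eq_big_nat => i ir.
  rewrite /= -(alpha_moment ir) mulr_suml; apply: eq_bigr => j _.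
  by rewrite mulmxnE mulr_natr mulrnAr.
apply: xget_unique; first by exists m.
move=> _ [m' e ->]; have := phiE m'; rewrite -e phiE.
by move/(mulfI (isT : - 2 != 0 :> int)) => -[].
Qed.

(* Main.v *)
Require Import Defs.
From mathcomp Require Import perm zify ring.
From mathcomp Require Import all_boot all_order all_algebra finmap.
From mathcomp Require Import boolp classical_sets functions cardinality fsbigop.
Set Implicit Arguments.
Unset Strict Implicit.
Unset Printing Implicit Defensive.
Import Order.TTheory GRing.Theory Num.Theory.
Local Open Scope ring_scope.

(** Display a multipartition on an abacus: each component has a runner whose
    positions are the integers, and the beads of component [k] occupy its
    beta-set shifted by [a_k].  Removing or adding an [i]-node moves a bead
    between the positions [i - 1] and [i] of one runner.  Counting such moves
    shows that [theta_i = d_i - d_(i-1)], where [d_i] is the number of beads in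
    position [i] over all runners ([hubE]); so these are the [d_i] of the
    definition of [v] ([dsum_hub]).  Moreover [d_i - D_i = c_i - c_(i+1)], where
    [D_i = #{k : i < a_k}] belongs to the empty multipartition
    ([content_step]).  In particular hub and content determine each other, which
    gives the uniqueness of the block ([hub_content], [content_hub]).

    Conversely, any 0-1 configuration of beads with the right number of beads on
    each runner comes from a multipartition ([part_of_beads]).  Therefore a hub
    occurs exactly when there is a 0-1 matrix, with rows indexed by positions and
    columns by runners, with row sums [d_i] and column sums prescribed by the
    charges [a_k].  The Gale-Ryser theorem ([gale_ryser]) says when this is
    possible: [0 <= d_i <= r], the total sums agree, and for each [p] the number
    [m_p], the sum over [i] of [min(d_i, p) - min(D_i, p)], is nonnegative.

    These [m_p] are the coefficients in [v(theta) - v(Theta)].  Indeed the vector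
    [v] lists how often each value [j] occurs among the [d_i], suitably
    normalised ([v_entryE]), so pairing [v(theta) - v(Theta)] with a function [g]
    gives the sum of [g(d_i) - g(D_i)] ([v_diff_pairing]), while pairing [alpha_q]
    with [g] gives minus the second difference of [g] at [q] ([alpha_pairing]).
    For [g = min(-, p)] this is 1 for [q = p] and 0 otherwise.  The two directions
    are [hub_mapsto] and [mapsto_hub].

    The weight comes from [g(j) = j^2]: the height is minus half the sum of
    [d_i^2 - D_i^2], and expanding [d_i = D_i + (c_i - c_(i+1))] gives the formula
    that defines the weight ([weightE], [weight_ht]). *)

(** * Matrices with given row and column sums *)

Lemma bigD2 (I : finType) (P : pred I) (F : I -> nat) (k l : I) :
  k != l -> P k -> P l ->
  (\sum_(j | P j) F j =
   F k + F l + \sum_(j | [&& P j, j != k & j != l]) F j)%N.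
Proof.
move=> kl Pk Pl; rewrite (bigD1 k) //= (bigD1 l) /= ?Pl 1?eq_sym // addnA.
by under eq_bigl do rewrite -andbA.
Qed.

Section GaleRyser.
Variables (T : finType) (r : nat) (d : T -> nat) (a : 'I_r -> nat).
Hypothesis a_decr : forall i j : 'I_r, (i <= j)%N -> (a j <= a i)%N.

(** Column [j] of a 0-1 matrix is the set [B j] of rows in which it has a 1. *)
Definition arrangement (B : 'I_r -> {set T}) :=
  (forall x, \sum_j (x \in B j : nat) = d x)%N.

Definition dominates (B : 'I_r -> {set T}) :=
  forall p, (\sum_(j < r | j < p) a j <= \sum_(j < r | j < p) #|B j|)%N.

Definition transfer (B : 'I_r -> {set T}) (k l : 'I_r) x j :=
  if j == k then B k :\ x else if j == l then x |: B l else B j.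

Lemma transfer_arrangement (B : 'I_r -> {set T}) (k l : 'I_r) (x : T) :
  k != l -> x \in B k -> x \notin B l ->
  arrangement B -> arrangement (transfer B k l x).
Proof.
move=> kl xk xl arrB y; rewrite -[RHS]arrB.
have lk : l != k by rewrite eq_sym.
rewrite (bigD2 _ kl) // [RHS](bigD2 _ kl) //=; congr (_ + _)%N.
  rewrite /transfer eqxx (negPf lk) eqxx !inE.
  by case: (y =P x) => [->|//]; rewrite xk (negPf xl).
by apply: eq_bigr => j /andP[/negPf jk /negPf jl]; rewrite /transfer jk jl.
Qed.

(** Let [l] be the first column with fewer than [a l] elements.  Dominance at
    [l] forces an earlier column [k] with a surplus, and since [a] decreases,
    [#|B l| < a l <= a k < #|B k|]: some row has a 1 in column [k] but not in
    column [l], and this 1 can be moved.  No column before [l] has a deficit,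
    which is what keeps dominance after the move. *)
Lemma exists_transfer (B : 'I_r -> {set T}) n :
  dominates B -> (\sum_j (a j - #|B j|) = n.+1)%N ->
  exists (k l : 'I_r) (x : T), [/\ (k < l)%N, x \in B k, x \notin B l,
    (a k < #|B k|)%N /\ (#|B l| < a l)%N &
    forall j : 'I_r, (j < l)%N -> (a j <= #|B j|)%N].
Proof.
move=> domB defB.
have [l0 l0P] : exists l : 'I_r, (#|B l| < a l)%N.
  apply/existsP; apply: contraT; rewrite negb_exists => /forallP noP.
  by move: defB; rewrite big1 // => j _; have := noP j; lia.
case: (@arg_minnP _ l0 (fun l => (#|B l| < a l)%N) (@nat_of_ord r)) => // l lP lmin.
have before_l (j : 'I_r) : (j < l)%N -> (a j <= #|B j|)%N.
  by move=> jl; rewrite leqNgt; apply/negP => /lmin; rewrite leqNgt jl.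
have [k kl kP] : exists2 k : 'I_r, (k < l)%N & (a k < #|B k|)%N.
  suff /existsP[k /andP[]]: [exists k : 'I_r, (k < l)%N && (a k < #|B k|)%N].
    by exists k.
  apply: contraT; rewrite negb_exists => /forallP noP.
  have := domB l.+1; rewrite (bigD1 l) //= [X in (_ <= X)%N](bigD1 l) //=.
  apply: contraLR => _; rewrite -ltnNge -addSn leq_add // leq_sum // => j.
  move=> /andP[jl jNl]; have := noP j.
  have -> : (j < l)%N by move: jl jNl; rewrite -val_eqE /=; lia.
  by rewrite /= -leqNgt.
have akl := a_decr (ltnW kl).
have [x xk xl] : exists2 x, x \in B k & x \notin B l.
  by apply/subsetPn; apply/negP => /subset_leq_card; lia.
by exists k, l, x.
Qed.

(** Only the prefix sums of length [p] with [k < p <= l] change.  For these,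
    dominance holds term by term, as every column before [l] still has at
    least its prescribed size. *)
Lemma transfer_step (B : 'I_r -> {set T}) n :
  arrangement B -> dominates B -> (\sum_j (a j - #|B j|) = n.+1)%N ->
  exists B', [/\ arrangement B', dominates B' &
                 (\sum_j (a j - #|B' j|) = n)%N].
Proof.
move=> arrB domB defB.
have [k [l [x [kl xk xl [kP lP] before_l]]]] := exists_transfer domB defB.
have neq_kl : k != l by rewrite -val_eqE /= neq_ltn kl.
have neq_lk : l != k by rewrite eq_sym.
have card_k : (#|transfer B k l x k|.+1 = #|B k|)%N.
  by rewrite /transfer eqxx (cardsD1 x (B k)) xk.
have card_l : #|transfer B k l x l| = #|B l|.+1.
  by rewrite /transfer (negPf neq_lk) eqxx cardsU1 xl.
have card_other j : j != k -> j != l -> transfer B k l x j = B j.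
  by move=> /negPf jk /negPf jl; rewrite /transfer jk jl.
move: (transfer B k l x) (transfer_arrangement neq_kl xk xl arrB)
  card_k card_l card_other => B' arrB' card_k card_l card_other.
exists B'; split=> //.
- move=> p; case: (leqP p l) => [pl|lp].
    apply: leq_sum => j jp; have jl := leq_trans jp pl.
    have [->|jk] := eqVneq j k; first by lia.
    by rewrite card_other ?before_l // -val_eqE /= neq_ltn jl.
  apply: leq_trans (domB p) _.
  have kp := ltn_trans kl lp.
  rewrite (bigD2 _ neq_kl) // [X in (_ <= X)%N](bigD2 _ neq_kl) //.
  rewrite leq_add //; first by lia.
  by apply: leq_sum => j /and3P[_ jk jl]; rewrite card_other.
- move: defB; rewrite (bigD2 _ neq_kl) // [in X in _ -> X](bigD2 _ neq_kl) //=.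
  rewrite [X in _ -> (_ + X = _)%N](eq_bigr (fun j => a j - #|B j|)%N).
    by lia.
  by move=> j /andP[jk jl]; rewrite card_other.
Qed.

Lemma sum_ord_ltn m n p : (\sum_(j < n | (j < p)%N) (j < m)%N =
  minn n (minn m p))%N.
Proof.
elim: n => [|n IHn]; first by rewrite big_ord0 min0n.
by rewrite big_mkcond big_ord_recr -big_mkcond /= IHn; case: ifP; lia.
Qed.

(** The left-justified matrix, whose row [x] has its 1s in the first [d x]
    columns, has the largest possible prefix sums of column sizes; the sum of
    the first [p] is the sum of the [minn (d x) p].  Transfers then bring the
    column sizes down to [a], each removing one unit of total deficit. *)
Theorem gale_ryser :
  (forall x, (d x <= r)%N) ->
  (\sum_j a j = \sum_x d x)%N ->
  (forall p, (\sum_(j < r | j < p) a j <= \sum_x minn (d x) p)%N) ->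
  exists B : 'I_r -> {set T},
    (forall x, \sum_j (x \in B j : nat) = d x)%N /\ (forall j, #|B j| = a j).
Proof.
move=> d_le sum_ad dom_ad.
pose B0 (j : 'I_r) := [set x | (j < d x)%N].
have arrB0 : arrangement B0.
  move=> x; have := sum_ord_ltn (d x) r r; rewrite (minn_idPl (d_le x)).
  rewrite (minn_idPr (d_le x)); apply: etrans.
  by apply: eq_big => j; rewrite ?ltn_ord ?inE.
have domB0 : dominates B0.
  move=> p; apply: leq_trans (dom_ad p) _; rewrite leq_eqVlt; apply/orP; left.
  apply/eqP; under [RHS]eq_bigr do rewrite -sum1_card big_mkcond /=.
  rewrite exchange_big /=; apply: eq_bigr => x _.
  transitivity (\sum_(j < r | (j < p)%N) (j < d x)%N)%N.
    by rewrite sum_ord_ltn; have := d_le x; lia.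
  by apply: eq_bigr => j _; rewrite inE; case: ltnP.
have [B [arrB defB]] : exists B, arrangement B /\ (\sum_j (a j - #|B j|) = 0)%N.
  move: {-1}(\sum_j _)%N (erefl (\sum_j (a j - #|B0 j|))%N) => n.
  elim: n B0 arrB0 domB0 => [|n IHn] B arrB domB defB; first by exists B.
  by have [B' [arrB' domB' /IHn]] := transfer_step arrB domB defB; apply.
have a_le j : (a j <= #|B j|)%N.
  by apply/eqP; move/eqP: defB; rewrite sum_nat_eq0 => /forallP/(_ j)/eqP.
exists B; split=> // j; apply/eqP; rewrite eqn_leq a_le andbT.
have : (\sum_j #|B j| = \sum_j a j)%N.
  rewrite sum_ad; under eq_bigr do rewrite -sum1_card big_mkcond /=.
  rewrite exchange_big /=; apply: eq_bigr => x _; rewrite -arrB.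
  by apply: eq_bigr => i _; case: (x \in B i).
rewrite (bigD1 j) //= [RHS](bigD1 j) //= => total.
rewrite -(leq_add2r (\sum_(i < r | i != j) a i)) -total leq_add2l.
by apply: leq_sum.
Qed.
End GaleRyser.

(** * Partitions, diagonals and beads *)

Definition in_part (p : intpart) (x y : nat) : bool := (y < nth 0%N (val p) x)%N.

Lemma nth_part_noninc (p : intpart) x x' :
  (x' <= x)%N -> (nth 0 (val p) x <= nth 0 (val p) x')%N.
Proof.
case: p => s /= /andP[s_sorted _] le_x.
case: (ltnP x (size s)) => [xs|sx]; last by rewrite nth_default.
have geq_tr : transitive geq by move=> u v w /= uv /leq_trans; apply.
by apply: (sorted_leq_nth geq_tr leqnn 0%N s_sorted); rewrite ?inE ?(leq_ltn_trans le_x).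
Qed.

Lemma in_part_closed (p : intpart) x y x' y' :
  (x' <= x)%N -> (y' <= y)%N -> in_part p x y -> in_part p x' y'.
Proof.
rewrite /in_part => /(nth_part_noninc p) le_nth le_y lt_y.
exact: leq_ltn_trans le_y (leq_trans lt_y le_nth).
Qed.

Lemma in_part_size (p : intpart) x y : in_part p x y -> (x < size (val p))%N.
Proof. by rewrite /in_part; case: (ltnP x (size (val p))) => // /(nth_default 0%N) ->. Qed.

Lemma ltn_count_iota (Q : pred nat) N k :
  (forall k, Q k.+1 -> Q k) -> (forall k, Q k -> (k < N)%N) ->
  (k < count Q (iota 0 N))%N = Q k.
Proof.
move=> Qdown; elim: N => [|N IHN] bQ.
  by apply/esym/negP => /bQ.
have -> : iota 0 N.+1 = iota 0 N ++ [:: N] by rewrite -[N.+1]addn1 iotaD.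
rewrite count_cat /= addn0.
case QN : (Q N).
  have Qle j : (j <= N)%N -> Q j.
    move=> jN; rewrite -(subKn jN); elim: (N - j)%N => [|i IHi]; first by rewrite subn0.
    have [Ni|iN] := leqP N i; last by apply: Qdown; rewrite subnSK.
    by rewrite (_ : N - i.+1 = N - i)%N // ; lia.
  have /eqP -> : count Q (iota 0 N) == N.
    rewrite -{2}(size_iota 0 N) -all_count; apply/allP => j.
    by rewrite mem_iota => /andP[_ jN]; apply: Qle; rewrite ltnW.
  apply/idP/idP => [kN|/bQ]; last by rewrite addn1.
  by apply: Qle; move: kN; rewrite addn1 ltnS.
rewrite addn0 IHN // => j Qj; have := bQ j Qj; rewrite ltnS leq_eqVlt.
by case/orP=> // /eqP jN; rewrite jN QN in Qj.
Qed.

(** A finite set of nodes closed under moving up and left is a Young diagram: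
    the row lengths, cut off at the length of the first column, are the parts. *)
Lemma part_of_set (P : nat -> nat -> bool) N :
  (forall x y, P x.+1 y -> P x y) -> (forall x y, P x y.+1 -> P x y) ->
  (forall x y, P x y -> (x < N)%N /\ (y < N)%N) ->
  exists p : intpart, forall x y, in_part p x y = P x y.
Proof.
move=> Px Py PN.
pose row x := count (P x) (iota 0 N).
have rowE x y : (y < row x)%N = P x y.
  by apply: ltn_count_iota => z; [exact: Py | case/PN].
pose h := count (fun x => P x 0%N) (iota 0 N).
have hE x : (x < h)%N = P x 0%N.
  by apply: (ltn_count_iota (Q := fun x => P x 0%N)) => z; [exact: Px | case/PN].
pose s := mkseq row h.
have sP : sorted geq s && (0%N \notin s).
  apply/andP; split.
    apply/(sortedP 0%N) => i; rewrite size_mkseq => ih.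
    rewrite !nth_mkseq ?(ltn_trans (ltnSn i) ih) //= leqNgt; apply/negP; rewrite rowE => /Px.
    by rewrite -rowE ltnn.
  rewrite /s /mkseq; apply/negP => /mapP[x]; rewrite mem_iota add0n /= hE => Px0 row0.
  by have := rowE x 0%N; rewrite -row0 Px0.
exists (exist _ s sP) => x y; rewrite /in_part /=.
have [xh|hx] := ltnP x h; first by rewrite nth_mkseq ?rowE.
rewrite nth_default ?size_mkseq // ltn0.
apply/esym/negP => Pxy; have : P x 0%N.
  by elim: y Pxy => // y IHy /Py.
by rewrite -hE ltnNge hx.
Qed.

(** Diagonal [l] consists of the nodes [(x, y)] with [y - x = l]; its [s]-th
    node, counted from the border, is the one with [minn x y = s]. *)
Definition diag_node (l : int) (s : nat) : nat * nat :=
  if (0 <= l)%R then (s, s + `|l|)%N else (s + `|l|, s)%N.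

Definition diag_len (p : intpart) (l : int) : nat :=
  count (fun s => in_part p (diag_node l s).1 (diag_node l s).2)
        (iota 0 (size (val p))).

Lemma diag_nodeK x y : diag_node (y%:Z - x%:Z) (minn x y) = (x, y).
Proof. by rewrite /diag_node; case: ifP => ?; congr pair; lia. Qed.

Lemma diag_node_diag l s : (diag_node l s).2%:Z - (diag_node l s).1%:Z = l.
Proof. by rewrite /diag_node; case: ifP => ? /=; lia. Qed.

Lemma diag_node_min l s : minn (diag_node l s).1 (diag_node l s).2 = s.
Proof. by rewrite /diag_node; case: ifP => ? /=; lia. Qed.

Lemma in_diag_node p l s :
  in_part p (diag_node l s).1 (diag_node l s).2 = (s < diag_len p l)%N.
Proof.
apply/esym; apply: (ltn_count_iota (Q := fun s => in_part p (diag_node l s).1 (diag_node l s).2)).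
  by move=> k; apply: in_part_closed; rewrite /diag_node; case: ifP => _ /=; lia.
move=> k /in_part_size; apply: leq_ltn_trans.
by rewrite /diag_node; case: ifP => _ /=; lia.
Qed.

(** A Young diagram meets each diagonal in an initial segment, so that the
    diagonal lengths determine it. *)
Lemma in_partE p x y : in_part p x y = (minn x y < diag_len p (y%:Z - x%:Z))%N.
Proof. by rewrite -in_diag_node diag_nodeK. Qed.

Lemma diag_len_step p (l : int) :
  if 0 <= l then (diag_len p (l + 1) <= diag_len p l <= (diag_len p (l + 1)).+1)%N
  else (diag_len p l <= diag_len p (l + 1) <= (diag_len p l).+1)%N.
Proof.
have lt_le m n : (forall s, s < m -> s < n)%N -> (m <= n)%N.
  by case: m => // m; apply.
have lt_le1 m n : (forall s, s.+1 < m -> s < n)%N -> (m <= n.+1)%N.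
  by case: m => [|[|m]] // H; apply: H.
case: ifP => l0; apply/andP; split; [apply: lt_le|apply: lt_le1|apply: lt_le|apply: lt_le1];
  move=> s; rewrite -!in_diag_node; apply: in_part_closed; rewrite /diag_node;
  repeat case: ifP => ? /=; lia.
Qed.

(** The beta-set of the partition, with the empty partition having its beads
    at the negative positions.  A bead moves from position [l - 1] to [l] when
    a node is added on diagonal [l], which lengthens that diagonal by 1; hence
    the expression of the beads by differences of diagonal lengths. *)
Definition bead (p : intpart) (l : int) : bool :=
  ((l < 0)%R%:Z + (diag_len p l)%:Z - (diag_len p (l + 1))%:Z == 1).

Lemma beadE p l :
  (bead p l)%:Z = (l < 0)%R%:Z + (diag_len p l)%:Z - (diag_len p (l + 1))%:Z.
Proof. by rewrite /bead; have /= := diag_len_step p l; case: ifP; case: ltP; lia. Qed.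

(** A removable node on diagonal [l] is a bead at [l] with a gap at [l - 1],
    and it has to be the last node of its diagonal. *)
Lemma last_nodeE p x y :
  [&& in_part p x y, ~~ in_part p x.+1 y & ~~ in_part p x y.+1] =
  [&& bead p (y%:Z - x%:Z), ~~ bead p (y%:Z - x%:Z - 1) &
      minn x y == (diag_len p (y%:Z - x%:Z)).-1].
Proof.
rewrite !in_partE; set l := y%:Z - x%:Z.
have -> : y%:Z - x.+1%:Z = l - 1 by lia.
have -> : y.+1%:Z - x%:Z = l + 1 by lia.
have := beadE p l; have := beadE p (l - 1); rewrite subrK.
move: (diag_len p (l - 1)) (diag_len p l) (diag_len p (l + 1)) => c0 c1 c2.
by case: (bead p l); case: (bead p (l - 1)) => /=; case: (ltP l 0); case: (ltP (l - 1) 0); lia.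
Qed.

(** Dually, an addable node on diagonal [l] is a bead at [l - 1] with a gap at
    [l]. *)
Lemma next_nodeE p x y :
  [&& ~~ in_part p x y, (x == 0%N) || in_part p x.-1 y & (y == 0%N) || in_part p x y.-1] =
  [&& ~~ bead p (y%:Z - x%:Z), bead p (y%:Z - x%:Z - 1) &
      minn x y == diag_len p (y%:Z - x%:Z)].
Proof.
have up : x != 0%N -> in_part p x.-1 y = (minn x.-1 y < diag_len p (y%:Z - x%:Z + 1))%N.
  by move=> x0; rewrite in_partE; congr (_ < diag_len p _)%N; lia.
have left : y != 0%N -> in_part p x y.-1 = (minn x y.-1 < diag_len p (y%:Z - x%:Z - 1))%N.
  by move=> y0; rewrite in_partE; congr (_ < diag_len p _)%N; lia.
rewrite [in_part p x y]in_partE; move: up left; set l := y%:Z - x%:Z => up left.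
have := beadE p l; have := beadE p (l - 1); rewrite subrK.
have [x0|x0] := eqVneq x 0%N; have [y0|y0] := eqVneq y 0%N;
  rewrite ?(up x0) ?(left y0) /=;
  move: (diag_len p (l - 1)) (diag_len p l) (diag_len p (l + 1)) => c0 c1 c2;
  by case: (bead p l); case: (bead p (l - 1)) => /=; case: (ltP l 0); case: (ltP (l - 1) 0); lia.
Qed.

Lemma eq_diag_len p l n : (forall s, (s < diag_len p l)%N = (s < n)%N) -> diag_len p l = n.
Proof. by move=> H; have := H (diag_len p l); have := H n; lia. Qed.

(** * Hub and content in terms of beads *)

Local Open Scope classical_set_scope.

Lemma ncard_seq (T : choiceType) (A : set T) (s : seq T) :
  uniq s -> (forall x, A x <-> x \in s) -> ncard A = size s.
Proof.
move=> s_uniq As; have -> : A = [set` [fset x in s]%fset].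
  by apply/seteqP; split=> x /=; rewrite !inE => /As.
by rewrite /ncard set_fsetK card_fseq undup_id.
Qed.

Lemma posz_sum (I : Type) (s : seq I) (P : pred I) (F : I -> nat) :
  (\sum_(i <- s | P i) F i)%N%:Z = \sum_(i <- s | P i) (F i)%:Z.
Proof. by rewrite -natz natr_sum; apply: eq_bigr => i _; rewrite natz. Qed.

Section Diagrams.
Variables (r : nat) (lam : multipartition r).

Definition replace_part (k : 'I_r) (p : intpart) : multipartition r :=
  [ffun k' => if k' == k then p else lam k'].

Lemma in_part_bounded (p : intpart) x y :
  in_part p x y -> (x < size (val p) + nth 0%N (val p) 0)%N /\
                   (y < size (val p) + nth 0%N (val p) 0)%N.
Proof.
move=> pxy; have xs := in_part_size pxy; split; first by rewrite ltn_addr.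
have : in_part p 0 y by apply: in_part_closed pxy.
by rewrite /in_part => ?; rewrite ltn_addl.
Qed.

Lemma diagram_closed (mu : multipartition r) x y x' y' k :
  (x' <= x)%N -> (y' <= y)%N -> diagram mu (x, y, k) -> diagram mu (x', y', k).
Proof. exact: in_part_closed. Qed.

Lemma removableP x y (k : 'I_r) :
  removable lam (x, y, k) <->
  [&& in_part (lam k) x y, ~~ in_part (lam k) x.+1 y & ~~ in_part (lam k) x y.+1].
Proof.
split.
  case=> lam_n [mu mu_eq]; have not_mu : ~ diagram mu (x, y, k).
    by rewrite mu_eq => -[_]; apply.
  apply/and3P; split=> //; apply/negP => nlam; apply: not_mu.
    apply: (@diagram_closed _ x.+1 y) => //; rewrite mu_eq; split=> //=.
    by case=> /eqP; rewrite eqn_leq ltnn.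
  apply: (@diagram_closed _ x y.+1) => //; rewrite mu_eq; split=> //=.
  by case=> /eqP; rewrite eqn_leq ltnn.
case/and3P=> in_xy out_x out_y; split=> //.
have [x' y'|x' y'|x' y' /andP[/in_part_bounded]|p pE] := @part_of_set
    (fun x' y' => in_part (lam k) x' y' && ((x', y') != (x, y)))
    (size (val (lam k)) + nth 0%N (val (lam k)) 0) _ _ _ => //.
- case/andP=> in' _; apply/andP; split; first by apply: in_part_closed in'.
  by apply/eqP => -[ex ey]; rewrite ex ey (negPf out_x) in in'.
- case/andP=> in' _; apply/andP; split; first by apply: in_part_closed in'.
  by apply/eqP => -[ex ey]; rewrite ex ey (negPf out_y) in in'.
exists (replace_part k p); apply/seteqP; split=> -[[x' y'] k'];
  rewrite /diagram /= ffunE; have [->|kk'] := eqVneq k' k.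
- rewrite -/(in_part p x' y') pE => /andP[? /eqP ne].
  by split=> // -[? ?]; apply: ne; congr pair.
- by split=> // -[_ _ e]; rewrite e eqxx in kk'.
- case=> in' ne; rewrite -/(in_part p x' y') pE; apply/andP; split=> //.
  by apply/eqP => -[? ?]; apply: ne; congruence.
- by case.
Qed.

Lemma addableP x y (k : 'I_r) :
  addable lam (x, y, k) <->
  [&& ~~ in_part (lam k) x y, (x == 0%N) || in_part (lam k) x.-1 y &
      (y == 0%N) || in_part (lam k) x y.-1].
Proof.
split.
  case=> /negP out [mu mu_eq]; have in_mu : diagram mu (x, y, k).
    by rewrite mu_eq; left.
  apply/and3P; split=> //.
    case: x => // x in out mu_eq in_mu *; rewrite /=.
    have : diagram mu (x, y, k) by apply: diagram_closed in_mu.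
    by rewrite mu_eq => -[[/eqP]|//]; rewrite eqn_leq ltnn andbF.
  case: y => // y in out mu_eq in_mu *; rewrite /=.
  have : diagram mu (x, y, k) by apply: diagram_closed in_mu.
  by rewrite mu_eq => -[[/eqP]|//]; rewrite eqn_leq ltnn andbF.
case/and3P=> out in_x in_y; split; first exact/negP.
have [x' y'|x' y'|x' y'|p pE] := @part_of_set
    (fun x' y' => in_part (lam k) x' y' || ((x', y') == (x, y)))
    (size (val (lam k)) + nth 0%N (val (lam k)) 0 + x.+1 + y.+1) _ _ _ => //.
- case/orP=> [in'|/eqP[ex ey]]; first by rewrite (in_part_closed _ _ in').
  by move: in_x; rewrite -ex -ey /= => ->.
- case/orP=> [in'|/eqP[ex ey]]; first by rewrite (in_part_closed _ _ in').
  by move: in_y; rewrite -ex -ey /= => ->.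
- by case/orP=> [/in_part_bounded|/eqP[-> ->]]; lia.
exists (replace_part k p); apply/seteqP; split=> -[[x' y'] k'];
  rewrite /diagram /= ffunE; have [->|kk'] := eqVneq k' k.
- by rewrite -/(in_part p x' y') pE => /orP[|/eqP[-> ->]]; [right|left].
- by right.
- by case=> [[-> ->]|in']; rewrite -/(in_part p _ _) pE ?eqxx ?orbT //; apply/orP; left.
- by case=> // -[_ _ e]; rewrite e eqxx in kk'.
Qed.

Section Charged.
Variable a : 'I_r -> int.

(** On an abacus with one runner for each component, runner [k] shifted by
    [a k], this is the number of beads in position [i].  It turns out to be
    [d_i] of the hub. *)
Definition bead_count (i : int) : nat := (\sum_(k < r) bead (lam k) (i - a k))%N.

(** In each component at most one node of residue [i] can be removable or
    addable, namely the node [f k] of its diagonal [i - a k]. *)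
Lemma ncard_nodes (A : set (node r)) (P : pred 'I_r) (f : 'I_r -> nat) (i : int) :
  (forall x y k, A (x, y, k) /\ residue a (x, y, k) = i <->
     [&& P k, minn x y == f k & y%:Z - x%:Z == i - a k]) ->
  (ncard (A `&` [set n | residue a n = i]))%:Z = \sum_k (P k)%:Z.
Proof.
move=> AP; rewrite (@ncard_seq _ _ [seq (diag_node (i - a k) (f k), k) | k <- enum P]).
- rewrite size_map -cardE -sum1_card -natz natr_sum big_mkcond /=.
  by apply: eq_bigr => k _; rewrite -topredE /=; case: (P k).
- by rewrite map_inj_uniq ?enum_uniq // => k k' [].
move=> [[x y] k]; split=> [/(AP x y k).1/and3P[Pk /eqP mE /eqP dE]|/mapP[k' Pk' [xyE kE]]].
  by apply/mapP; exists k; rewrite ?mem_enum // -mE -dE diag_nodeK.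
move: Pk'; rewrite mem_enum -kE in xyE * => Pk; apply: (AP x y k).2; apply/and3P.
have [-> ->] : x = (diag_node (i - a k) (f k)).1 /\ y = (diag_node (i - a k) (f k)).2.
  by rewrite -xyE.
by rewrite diag_node_min diag_node_diag.
Qed.

Lemma residueE x y k i : residue a (x, y, k) = i <-> y%:Z - x%:Z = i - a k.
Proof. by rewrite /residue /=; split; lia. Qed.

Lemma hubE i : hub a lam i = (bead_count i)%:Z - (bead_count (i - 1))%:Z.
Proof.
have shift k : i - 1 - a k = i - a k - 1 by lia.
rewrite /hub.
rewrite (@ncard_nodes _ (fun k => bead (lam k) (i - a k) && ~~ bead (lam k) (i - 1 - a k))
  (fun k => (diag_len (lam k) (i - a k)).-1)); last first.
  move=> x y k; split.
    case=> /removableP; rewrite last_nodeE shift => /and3P[b b' m] /residueE e.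
    by move: b b' m; rewrite -e eqxx => -> -> ->.
  case/and3P=> /andP[b b'] m /eqP e; split; last exact/residueE.
  by apply/removableP; rewrite last_nodeE e -shift b b' m.
rewrite (@ncard_nodes _ (fun k => ~~ bead (lam k) (i - a k) && bead (lam k) (i - 1 - a k))
  (fun k => diag_len (lam k) (i - a k))); last first.
  move=> x y k; split.
    case=> /addableP; rewrite next_nodeE shift => /and3P[b b' m] /residueE e.
    by move: b b' m; rewrite -e eqxx => -> -> ->.
  case/and3P=> /andP[b b'] m /eqP e; split; last exact/residueE.
  by apply/addableP; rewrite next_nodeE e -shift b b' m.
rewrite /bead_count !posz_sum -!sumrB; apply: eq_bigr => k _.
by case: (bead _ _); case: (bead _ _).
Qed.

Lemma contentE l : content a lam l = (\sum_(k < r) diag_len (lam k) (l - a k))%N.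
Proof.
rewrite /content (@ncard_seq _ _ [seq (diag_node (l - a k) s, k) |
    k <- enum 'I_r, s <- iota 0 (diag_len (lam k) (l - a k))]).
- rewrite size_allpairs_dep sumnE big_map big_enum /=.
  by apply: eq_bigr => k _; rewrite size_iota.
- apply: allpairs_uniq_dep => [|k _|]; rewrite ?enum_uniq ?iota_uniq //.
  move=> [k s] [k' s'] _ _ /= [e ekk']; rewrite -ekk' in e *; congr (Tagged _ _).
  by rewrite -(diag_node_min (l - a k) s) e diag_node_min.
move=> [[x y] k]; split=> [[] | /allpairsPdep[k' [s [_ + [xyE kE]]]]].
  rewrite -[diagram _ _]/(is_true (in_part (lam k) x y)).
  rewrite -[[set n | _] _]/(residue a (x, y, k) = l).
  rewrite in_partE => lt_c /residueE e.
  apply/allpairsPdep; exists k, (minn x y); rewrite mem_enum mem_iota add0n leq0n -e lt_c.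
  by rewrite diag_nodeK.
rewrite mem_iota add0n leq0n /= -kE => lt_c; rewrite -kE in xyE.
have [-> ->] : x = (diag_node (l - a k) s).1 /\ y = (diag_node (l - a k) s).2.
  by rewrite -xyE.
split; last by apply/residueE; rewrite diag_node_diag.
by rewrite -[diagram _ _]/(is_true (in_part (lam k) _ _)) in_diag_node.
Qed.

End Charged.
End Diagrams.

(** * The function d and the vector v of a hub *)

(** All functions of a residue that occur are constant on both sides of a
    bounded interval, and sums over the integers are taken over this one. *)
Definition window (N : nat) : seq int := [seq n%:Z - N%:Z | n <- iota 0 (N + N)].

Lemma mem_window N i : (i \in window N) = (- N%:Z <= i < N%:Z).
Proof.
apply/idP/idP => [/mapP[n]|/andP[i_ge i_lt]].
  by rewrite mem_iota => n_lt ->; lia.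
by apply/mapP; exists (absz (i + N%:Z)); rewrite ?mem_iota; lia.
Qed.

Lemma window_uniq N : uniq (window N).
Proof. by rewrite map_inj_uniq ?iota_uniq // => m n; lia. Qed.

Lemma telescope_window (V : zmodType) N (f : int -> V) :
  \sum_(i <- window N) (f i - f (i + 1)) = f (- N%:Z) - f N%:Z.
Proof.
rewrite big_map -[X in iota _ X]subn0 -/(index_iota _ _).
rewrite (@telescope_sumr_eq _ _ _ (fun n : nat => - f (n%:Z - N%:Z))) //.
  by rewrite PoszD addrK sub0r opprK addrC.
move=> n _ /=; rewrite opprK [RHS]addrC; congr (_ - f _); lia.
Qed.

Lemma ncard_window N (A : set int) (P : pred int) :
  (forall i, A i <-> P i) -> (forall i, P i -> - N%:Z <= i < N%:Z) ->
  (ncard A)%:Z = \sum_(i <- window N) (P i)%:Z.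
Proof.
move=> AP PN; rewrite (@ncard_seq _ _ (filter P (window N))).
- rewrite size_filter -sum1_count -natz natr_sum big_mkcond /=.
  by apply: eq_bigr => i _; case: (P i).
- by rewrite filter_uniq ?window_uniq.
by move=> i; rewrite mem_filter mem_window; split=> [/AP Pi|/andP[/AP]//]; rewrite Pi PN.
Qed.

(** The shape of the function [i |-> d_i]. *)
Definition profile (r N : nat) (d : int -> int) : Prop :=
  (forall i, i < - N%:Z -> d i = r%:Z) /\ (forall i, N%:Z <= i -> d i = 0).

Lemma int_diff_unique (f g : int -> int) (L : int) :
  (forall i, f i - f (i - 1) = g i - g (i - 1)) ->
  (forall i, i < L -> f i = g i) -> f =1 g.
Proof.
move=> step base i; have [/base//|Li] := ltP i L.
have -> : i = L - 1 + (absz (i - L + 1))%:Z by lia.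
elim: (absz _) => [|n IHn]; first by apply: base; lia.
have := step (L - 1 + n.+1%:Z).
by have -> : L - 1 + n.+1%:Z - 1 = L - 1 + n%:Z; lia.
Qed.

Lemma sum_below (theta : int -> int) (L i : int) (K : nat) :
  (forall l, l < L -> theta l = 0) -> i - K%:Z < L ->
  \sum_(l \in [set l : int | l <= i]) theta l = \sum_(n < K) theta (i - n%:Z).
Proof.
move=> theta0 iK; rewrite (fsbigE [seq i - n%:Z | n <- iota 0 K]).
- rewrite big_map -[X in iota _ X]subn0 -/(index_iota _ _) big_mkord.
  by apply: eq_bigl => n; apply: mem_set => /=; lia.
- by rewrite map_inj_uniq ?iota_uniq // => m n; lia.
- by move=> l /mapP[n _ ->] /=; lia.
move=> l /= li lNs; apply: theta0; rewrite ltNge; apply: contra lNs => Ll.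
by apply/mapP; exists (absz (i - l)); rewrite ?mem_iota; lia.
Qed.

Lemma dsum_profileE r N (theta d : int -> int) :
  profile r N d -> (forall i, theta i = d i - d (i - 1)) -> dsum r theta =1 d.
Proof.
move=> [dr _] thetaE i; pose K := absz (i + N%:Z + 1).
rewrite /dsum (@sum_below _ (- N%:Z) i K) //; first last.
- by rewrite /K; lia.
- by move=> l lN; rewrite thetaE !dr ?subrr //; lia.
rewrite -(big_mkord xpredT (fun n : nat => theta (i - n%:Z))).
rewrite (@telescope_sumr_eq _ _ _ (fun n : nat => - d (i - n%:Z))) //.
  by rewrite subr0 (dr (i - K%:Z)) 1?opprK ?addrA ?subrr ?add0r // /K; lia.
by move=> n _ /=; rewrite thetaE opprK [RHS]addrC; congr (_ - d _); lia.
Qed.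

Lemma hub_support r theta : is_hub r theta ->
  exists N : nat, forall l : int, (l < - N%:Z) || (N%:Z <= l) -> theta l = 0.
Proof.
case=> /finite_seqP[s sE] _; exists (\sum_(i <- s) (absz i).+1)%N => l lN.
apply/eqP; apply: contraT => theta_l.
have ls : l \in s by have : [set i | theta i != 0] l by []; rewrite sE.
have : ((absz l).+1 <= \sum_(i <- s) (absz i).+1)%N by rewrite (big_rem l ls) leq_addr.
by move: lN; lia.
Qed.

Lemma dsum_step r theta i : is_hub r theta -> dsum r theta i - dsum r theta (i - 1) = theta i.
Proof.
case/hub_support=> N thetaN; have theta0 l : l < - N%:Z -> theta l = 0.
  by move=> lN; rewrite thetaN ?lN.
rewrite /dsum (@sum_below _ _ i (absz (i + N%:Z + 1)).+1 theta0); last by lia.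
rewrite (@sum_below _ _ (i - 1) (absz (i + N%:Z + 1)) theta0); last by lia.
rewrite big_ord_recl subr0 (eq_bigr (fun n : 'I__ => theta (i - 1 - n%:Z))).
  by rewrite opprD addrACA subrr add0r addrK.
by move=> n _; congr theta; rewrite /= /bump /=; lia.
Qed.

Lemma dsum_profile r theta : is_hub r theta -> exists N, profile r N (dsum r theta).
Proof.
move=> hub_theta; have [N thetaN] := hub_support hub_theta.
have [_ sum_theta] := hub_theta; exists N; split=> i iN.
  rewrite /dsum fsbig1 ?addr0 // => l /= li; apply: thetaN.
  by apply/orP; left; exact: le_lt_trans li iN.
rewrite /dsum (fsbig_widen _ [set: int]) ?sum_theta ?subrr // => l [_ /= /negP].
by rewrite -ltNge => il; apply: thetaN; lia.
Qed.

Lemma profile_le r N N' d : (N <= N')%N -> profile r N d -> profile r N' d.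
Proof. by move=> NN' [dr d0]; split=> i ?; [apply: dr|apply: d0]; lia. Qed.

(** The function of [i] that the normalisation of [v_0] and [v_r] subtracts:
    with it, all entries of [v] are given by one formula. *)
Definition base_value (r : nat) (i : int) : int := if i < 0 then r%:Z else 0.

(** Each position [i] contributes [e_(d_i) - e_0] if [i >= 0] and
    [e_(d_i) - e_r] if [i < 0], where [e_d] is a unit vector, or zero when [d]
    is out of range. *)
Lemma v_entryE r N theta (j : 'I_r.+1) : (1 <= r)%N ->
  profile r N (dsum r theta) ->
  v r theta 0 j =
    \sum_(i <- window N) ((dsum r theta i == j%:Z)%:Z - (base_value r i == j%:Z)%:Z).
Proof.
move=> r_gt0; rewrite mxE /v0 /vr; move: (dsum r theta) => d [dr d0].
have [j0|j0] := eqVneq (j : nat) 0%N.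
  rewrite (@ncard_window N _ (fun i => (i < 0) && (d i == 0))); first last.
  - move=> i /andP[i0 /eqP di]; apply/andP; split; last lia.
    by rewrite leNgt; apply/negP => /dr; lia.
  - by move=> i; split=> [[-> ->] //|/andP[? /eqP ?]].
  rewrite (@ncard_window N _ (fun i => (0 <= i) && (d i != 0))); first last.
  - move=> i /andP[i0 /eqP di]; apply/andP; split; first lia.
    by rewrite ltNge; apply/negP => /d0.
  - by move=> i; split=> [[-> /eqP] //|/andP[? /eqP ?]].
  rewrite -sumrB; apply: eq_bigr => i _; rewrite j0 /base_value.
  by case: (ltP i 0) => _; case: (d i =P 0) => //; lia.
have [jr|jr] := eqVneq (j : nat) r.
  rewrite (@ncard_window N _ (fun i => (0 <= i) && (d i == r%:Z))); first last.
  - move=> i /andP[i0 /eqP di]; apply/andP; split; first lia.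
    by rewrite ltNge; apply/negP => /d0; lia.
  - by move=> i; split=> [[-> ->]|/andP[? /eqP ?] //]; rewrite eqxx.
  rewrite (@ncard_window N _ (fun i => (i < 0) && (d i != r%:Z))); first last.
  - move=> i /andP[i0 /eqP di]; apply/andP; split; last lia.
    by rewrite leNgt; apply/negP => /dr.
  - by move=> i; split=> [[-> /eqP] //|/andP[? /eqP ?]].
  rewrite -sumrB; apply: eq_bigr => i _; rewrite jr /base_value.
  by case: (ltP i 0) => _; case: (d i =P r%:Z) => //; lia.
rewrite (@ncard_window N _ (fun i => d i == j%:Z)); first last.
- move=> i /eqP di; apply/andP; split.
    by rewrite leNgt; apply/negP => /dr; lia.
  by rewrite ltNge; apply/negP => /d0; lia.
- by move=> i; split=> [->|/eqP].
apply: eq_bigr => i _; rewrite /base_value; case: ifP => _; lia.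
Qed.

(** * Pairings with the vectors alpha *)

Lemma sum_delta (R : pzRingType) n (g : nat -> R) m : (m < n)%N ->
  \sum_(j < n) g j * (m == j)%:R = g m.
Proof.
move=> mn; rewrite (bigD1 (Ordinal mn)) //= eqxx mulr1 big1 ?addr0 // => j.
by rewrite -val_eqE /= eq_sym => /negPf ->; rewrite mulr0.
Qed.

(** This is zero for affine [g] and nonnegative for concave [g]. *)
Lemma alpha_pairing r (g : nat -> int) q : (0 < q < r)%N ->
  \sum_(j < r.+1) g j * alpha r q 0 j = 2 * g q - g q.-1 - g q.+1.
Proof.
move=> /andP[q0 qr]; under eq_bigr do rewrite mxE !mulrDr !mulrN mulrCA.
rewrite !big_split /= !sumrN -mulr_sumr !sum_delta; [lia|lia|lia|lia].
Qed.

(** By induction on [d]: passing from [d] to [d + 1] adds 1 to the coefficients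
    with [p > d], and the sum of these [alpha]s telescopes, since [alpha] is
    itself a difference of [e_p - e_(p-1)]. *)
Lemma alpha_min r d (j : 'I_r.+1) : (0 < r)%N -> (d <= r)%N ->
  \sum_(1 <= p < r) alpha r p 0 j * (minn d p)%:Z =
  (d == j :> nat)%:R - (0%N == j)%:R + d%:Z * ((r.-1 == j)%:R - (r == j :> nat)%:R).
Proof.
move=> r_gt0; elim: d => [|d IHd] dr.
  by rewrite mul0r addr0 subrr big1 // => p _; rewrite min0n mulr0.
have step : \sum_(1 <= p < r) alpha r p 0 j * ((minn d.+1 p)%:Z - (minn d p)%:Z) =
   (d.+1 == j)%:R - (d == j :> nat)%:R + ((r.-1 == j)%:R - (r == j :> nat)%:R).
  rewrite (@big_cat_nat _ _ _ d.+1) //= [X in X + _]big_nat big1 ?add0r; last first.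
    by move=> p /andP[_ pd]; rewrite !(minn_idPr _) ?subrr ?mulr0 //; lia.
  pose u p : int := (p.-1 == j)%:R - (p == j :> nat)%:R.
  rewrite (@telescope_sumr_eq _ _ _ u) // => [|p /andP[dp _]].
    by rewrite /u /=; ring.
  rewrite (minn_idPl _) // (minn_idPl _) 1?ltnW // mxE /u -[p.+1.-1]/p.
  have -> : d.+1%:Z - d%:Z = 1 by lia.
  by move: (_ == _)%:R (_ == _)%:R (_ == _)%:R => x y z; lia.
transitivity (\sum_(1 <= p < r) alpha r p 0 j * ((minn d.+1 p)%:Z - (minn d p)%:Z) +
              \sum_(1 <= p < r) alpha r p 0 j * (minn d p)%:Z).
  by rewrite -big_split /=; apply: eq_bigr => p _; rewrite -mulrDr subrK.
rewrite step IHd ?(ltnW dr) //.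
have -> : d.+1%:Z = d%:Z + 1 by lia.
by move: (_ == _)%:R (_ == _)%:R (_ == _)%:R (_ == _)%:R (_ == _)%:R => x y z t w; ring.
Qed.

Lemma v_diffE r N theta theta' (d d' : int -> int) (j : 'I_r.+1) : (1 <= r)%N ->
  dsum r theta =1 d -> dsum r theta' =1 d' -> profile r N d -> profile r N d' ->
  (v r theta - v r theta') 0 j =
    \sum_(i <- window N) ((d i == j%:Z)%:Z - (d' i == j%:Z)%:Z).
Proof.
move=> r_gt0 /funext dE /funext dE' prof prof'.
rewrite mxE [X in _ + X]mxE (@v_entryE _ N) ?dE // (@v_entryE _ N) ?dE' // -sumrB.
by apply: eq_bigr => i _; ring.
Qed.

Lemma v_diff_pairing r N theta theta' (d d' : int -> nat) (g : nat -> int) :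
  (1 <= r)%N -> dsum r theta =1 (fun i => (d i)%:Z) -> dsum r theta' =1 (fun i => (d' i)%:Z) ->
  profile r N (fun i => (d i)%:Z) -> profile r N (fun i => (d' i)%:Z) ->
  (forall i, d i <= r)%N -> (forall i, d' i <= r)%N ->
  \sum_(j < r.+1) g j * (v r theta - v r theta') 0 j =
    \sum_(i <- window N) (g (d i) - g (d' i)).
Proof.
move=> r_gt0 dE dE' prof prof' d_le d_le'.
under eq_bigr do rewrite (v_diffE _ r_gt0 dE dE' prof prof') mulr_sumr.
rewrite exchange_big /=; apply: eq_bigr => i _.
under eq_bigr do rewrite mulrBr.
rewrite sumrB; congr (_ - _); rewrite -[RHS](sum_delta g (n := r.+1)) ?ltnS //;
  by apply: eq_bigr => j _; rewrite eqz_nat; case: (_ == _).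
Qed.

(** Each position where [d] leaves the interval [0, r] lowers the sum of the
    entries of [v] by 1, so equal sums confine [d] to it. *)
Lemma v_diff_sum r N theta theta' (d : int -> int) (d' : int -> nat) :
  (1 <= r)%N -> dsum r theta =1 d -> dsum r theta' =1 (fun i => (d' i)%:Z) ->
  profile r N d -> profile r N (fun i => (d' i)%:Z) -> (forall i, d' i <= r)%N ->
  \sum_(j < r.+1) (v r theta - v r theta') 0 j = 0 ->
  forall i, 0 <= d i <= r%:Z.
Proof.
move=> r_gt0 dE dE' prof prof' d_le' sum0.
have in_range (x : int) : \sum_(j < r.+1) (x == j%:Z)%:Z = (0 <= x <= r%:Z)%R%:Z.
  have [/andP[x0 xr]|x_out] := boolP (0 <= x <= r%:Z); last first.
    by apply: big1 => j _; case: eqP => // xj; move: x_out; rewrite xj; have := ltn_ord j; lia.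
  have xn : (absz x < r.+1)%N by lia.
  apply: etrans (sum_delta (fun=> 1 : int) xn); apply: eq_bigr => j _.
  by rewrite mul1r; lia.
have le1 i : 0 <= 1 - (0 <= d i <= r%:Z)%R%:Z :> int by case: (_ && _).
have : \sum_(i <- window N) (1 - (0 <= d i <= r%:Z)%R%:Z) = 0 :> int.
  transitivity (- \sum_(j < r.+1) (v r theta - v r theta') 0 j); last by rewrite sum0.
  under [in RHS]eq_bigr do rewrite (v_diffE _ r_gt0 dE dE' prof prof').
  rewrite exchange_big -sumrN /=; apply: eq_bigr => i _.
  by rewrite sumrB !in_range opprB; have := d_le' i; case: (_ && _); lia.
move/eqP; rewrite psumr_eq0 // => /allP winP i.
have [iN|] := boolP (i \in window N).
  by have := winP i iN; case: (_ && _).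
rewrite mem_window negb_and -!ltNge -leNgt => /orP[/(prof.1)|/(prof.2)] ->; lia.
Qed.

(** * Bead configurations *)

Lemma diag_len_eq0 p l :
  (size (val p) + nth 0 (val p) 0 <= absz l)%N -> diag_len p l = 0%N.
Proof.
move=> l_big; apply/eqP; rewrite -leqn0 leqNgt -in_diag_node.
apply/negP => /in_part_bounded; move: l_big; move: (size _ + _)%N => M.
by rewrite /diag_node; case: ifP => _ /=; lia.
Qed.

(** Outside of the window all diagonals are empty, and the beads are as in the
    empty multipartition.  The position [- N] counts as outside because the bead
    at [i] depends on the diagonals [i] and [i + 1]. *)
Definition fits r (a : 'I_r -> int) (lam : multipartition r) (N : nat) : Prop :=
  forall k l, (l <= - N%:Z) || (N%:Z <= l) ->
    diag_len (lam k) (l - a k) = 0%N /\ (l < a k) = (l < 0).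

Lemma fits_exists r (a : 'I_r -> int) (lam : multipartition r) :
  exists N0, forall N, (N0 <= N)%N -> fits a lam N.
Proof.
pose M k := (size (val (lam k)) + nth 0 (val (lam k)) 0 + (absz (a k)).+1)%N.
exists (\sum_k M k)%N => N NM k l lN.
have : (M k <= N)%N by apply: leq_trans NM; rewrite (bigD1 k) //= leq_addr.
have len0 := @diag_len_eq0 (lam k) (l - a k); move: len0; rewrite /M.
by move: (size _ + _)%N => m len0 Mk; split; [apply: len0|]; lia.
Qed.

Lemma fits_bead r (a : 'I_r -> int) lam N k i : fits a lam N ->
  (i < - N%:Z) || (N%:Z <= i) -> bead (lam k) (i - a k) = (i < 0).
Proof.
move=> fitN iN; have [|c0 ai] := fitN k i; first by lia.
have [|c1 _] := fitN k (i + 1); first by lia.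
have := beadE (lam k) (i - a k).
rewrite (_ : i - a k + 1 = i + 1 - a k) ?c0 ?c1 ?subr_lt0 ?ai; last by lia.
by case: (bead _ _); case: (i < 0).
Qed.

Lemma bead_count_le r (a : 'I_r -> int) lam i : (bead_count lam a i <= r)%N.
Proof.
rewrite -[X in (_ <= X)%N]card_ord -sum1_card; apply: leq_sum => k _.
by case: (bead _ _).
Qed.

Lemma fits_profile r (a : 'I_r -> int) lam N : fits a lam N ->
  profile r N (fun i => (bead_count lam a i)%:Z).
Proof.
move=> fitN; split=> i iN; rewrite /bead_count.
  rewrite (eq_bigr (fun=> 1%N)) ?sum1_card ?card_ord // => k _.
  by rewrite (fits_bead _ fitN) ?iN // (_ : i < 0); lia.
rewrite big1 // => k _; rewrite (fits_bead _ fitN) ?iN ?orbT //.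
by rewrite (_ : i < 0 = false); lia.
Qed.

Lemma dsum_hub r (a : 'I_r -> int) lam :
  dsum r (hub a lam) =1 (fun i => (bead_count lam a i)%:Z).
Proof.
have [N fitN] := fits_exists a lam.
apply: (dsum_profileE (fits_profile (fitN N (leqnn N)))) => i; exact: hubE.
Qed.

Lemma bead_empty l : bead empty_part l = (l < 0).
Proof.
have d0 m : diag_len empty_part m = 0%N by [].
by have := beadE empty_part l; rewrite !d0; case: (bead _ _); case: (l < 0).
Qed.

Lemma bead_count_empty r (a : 'I_r -> int) i :
  bead_count (empty_mpart r) a i = (\sum_k (i < a k)%R)%N.
Proof. by apply: eq_bigr => k _; rewrite ffunE bead_empty subr_lt0. Qed.

(** Moving beads along a runner does not change their number: the sum of the
    differences of consecutive diagonal lengths telescopes to 0. *)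
Lemma bead_charge r (a : 'I_r -> int) lam N k : fits a lam N ->
  \sum_(i <- window N) (bead (lam k) (i - a k))%:Z = \sum_(i <- window N) (i < a k)%R%:Z.
Proof.
move=> fitN; apply/eqP; rewrite -subr_eq0 -sumrB; apply/eqP.
transitivity (\sum_(i <- window N)
    ((diag_len (lam k) (i - a k))%:Z - (diag_len (lam k) (i + 1 - a k))%:Z)).
  apply: eq_bigr => i _; rewrite beadE subr_lt0.
  by rewrite (_ : i - a k + 1 = i + 1 - a k); lia.
rewrite (telescope_window N (fun i => (diag_len (lam k) (i - a k))%:Z)).
by rewrite !(fitN k _ _).1 ?lexx ?orbT // subrr.
Qed.

Lemma sum_window_tail N (f : int -> int) l :
  (forall i, i \notin window N -> f i = 0) ->
  \sum_(i <- window N | l <= i) f i - \sum_(i <- window N | l + 1 <= i) f i = f l.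
Proof.
move=> f0; rewrite big_mkcond [X in _ - X]big_mkcond -sumrB.
have [lN|/[dup] lN /f0 ->] := boolP (l \in window N).
  rewrite (bigD1_seq l) ?window_uniq //= big1 ?addr0 => [|i il]; last by case: ifP; case: ifP; lia.
  by rewrite lexx; case: ifP; lia.
rewrite big1_seq // => i /andP[_ iN]; have il : i != l by apply: contra lN => /eqP <-.
by case: ifP; case: ifP; lia.
Qed.

(** The partition with beads [b] has diagonal lengths
    [c l = sum_(i >= l) (b i - [i < a])].  Equality of the charges makes these
    nonnegative on both sides of [a] and zero far away; and as [c] decreases
    by 0 or 1 after [a], and increases by 0 or 1 before, the nodes that they
    describe form a Young diagram. *)
Lemma part_of_beads (b : int -> bool) (a : int) (N : nat) :
  (forall i, i \notin window N -> b i = (i < a)) ->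
  \sum_(i <- window N) ((b i)%:Z - (i < a)%R%:Z) = 0 ->
  exists p, forall i, bead p (i - a) = b i.
Proof.
move=> b_out b_sum; pose f i : int := (b i)%:Z - (i < a)%R%:Z.
have f0 (i : int) : i \notin window N -> f i = 0 by move=> /b_out; rewrite /f => ->; rewrite subrr.
pose c (l : int) : int := \sum_(i <- window N | l <= i) f i.
have c_step (l : int) : c l - c (l + 1) = f l by apply: sum_window_tail.
have c_compl (l : int) : c l = - \sum_(i <- window N | i < l) f i.
  apply/eqP; rewrite -addr_eq0; apply/eqP.
  rewrite -[RHS]b_sum [RHS](bigID (fun i => l <= i)) /=.
  by congr (_ + _); apply: eq_bigl => i; rewrite -ltNge.
have c_ge0 (l : int) : 0 <= c l.
  have [al|la] := leP a l.
    by apply: sumr_ge0 => i li; rewrite /f; case: (b i); lia.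
  rewrite c_compl -sumrN; apply: sumr_ge0 => i li.
  by rewrite /f; case: (b i); lia.
have c_out (l : int) : l \notin window N -> c l = 0.
  rewrite mem_window negb_and -!ltNge -leNgt => /orP[lN|Nl]; last first.
    by rewrite /c big_seq_cond big1 // => i /andP[]; rewrite mem_window; lia.
  by rewrite c_compl big_seq_cond big1 ?oppr0 // => i /andP[]; rewrite mem_window; lia.
pose M : int := \sum_(i <- window N) c i.
have c_bound (l : int) : c l <= M.
  have [lN|/c_out->] := boolP (l \in window N); last exact: sumr_ge0.
  by rewrite /M (bigD1_seq l) ?window_uniq //= lerDl sumr_ge0.
pose P x y := ((minn x y)%:Z < c (y%:Z - x%:Z + a)).
have cE (l : int) : c l = f l + c (l + 1) by rewrite -(c_step l) subrK.
have f_le (l : int) : if l < a then - 1 <= f l <= 0 else 0 <= f l <= 1.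
  by rewrite /f; case: (ltP l a); case: (b l).
have [x y|x y|x y Pxy|p pE] := @part_of_set P (2 * N + absz a + absz M)%N.
- rewrite /P; set l := y%:Z - x%:Z + a.
  have -> : y%:Z - x.+1%:Z + a = l - 1 by lia.
  have := cE (l - 1); have := f_le (l - 1); rewrite subrK => + ->.
  by case: ifP; lia.
- rewrite /P; set l := y%:Z - x%:Z + a.
  have -> : y.+1%:Z - x%:Z + a = l + 1 by lia.
  have := cE l; have := f_le l => + ->.
  by case: ifP; lia.
- have lN : y%:Z - x%:Z + a \in window N.
    by apply/negPn/negP => /c_out c0; move: Pxy; rewrite /P c0; lia.
  by move: Pxy (c_bound (y%:Z - x%:Z + a)) lN; rewrite mem_window /P; lia.
have lenE (l : int) : (diag_len p (l - a))%:Z = c l.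
  rewrite -[RHS]gez0_abs //; congr Posz; apply: eq_diag_len => s.
  rewrite -in_diag_node pE /P diag_node_min diag_node_diag subrK.
  by have := c_ge0 l; lia.
exists p => i; have := beadE p (i - a).
rewrite (_ : i - a + 1 = i + 1 - a) ?lenE; last by lia.
by rewrite -addrA c_step subr_lt0 /f addrC subrK; case: (bead _ _); case: (b i).
Qed.

Lemma sort_charges r (a : 'I_r -> int) :
  exists s : 'S_r, forall i j : 'I_r, (i <= j)%N -> a (s j) <= a (s i).
Proof.
pose le_a (x y : 'I_r) := a y <= a x.
pose t := sort le_a (enum 'I_r).
have le_tr : transitive le_a by move=> y x z xy yz; apply: le_trans yz xy.
have le_tot : total le_a by move=> x y; rewrite /le_a; case: ltP => //; lia.
have size_t : size t == r by rewrite size_sort -cardE card_ord.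
have : perm_eq (Tuple size_t) (ord_tuple r) by rewrite /= perm_sort.
case/tuple_permP=> s sE; exists s => i j ij.
have nth_t (k : 'I_r) : nth i t k = s k.
  transitivity (tnth [tuple tnth (ord_tuple r) (s i) | i < r] k).
    by rewrite (tnth_nth i) -sE.
  by rewrite tnth_mktuple tnth_ord_tuple.
rewrite -!nth_t; apply: (sorted_leq_nth le_tr _ i (sort_sorted le_tot _)) => //.
- by move=> x; apply: lexx.
- by rewrite inE (eqP size_t).
- by rewrite inE (eqP size_t).
Qed.

(** Downward closed [u] is the indicator function of an initial segment. *)
Lemma prefix_sum r (u : 'I_r -> bool) p :
  (forall i j : 'I_r, (i <= j)%N -> u j -> u i) ->
  (\sum_(j < r | (j < p)%N) u j = minn (\sum_(j < r) u j) p)%N.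
Proof.
move=> u_down; pose Q n := [exists j : 'I_r, (n <= j)%N && u j].
have QE (j : 'I_r) : Q j = u j.
  apply/existsP/idP => [[k /andP[jk]]|uj]; first exact: u_down.
  by exists j; rewrite leqnn.
pose n := count Q (iota 0 r).
have uE (j : 'I_r) : u j = (j < n)%N.
  rewrite -QE /n ltn_count_iota // => m /existsP[k /andP[mk uk]].
    by apply/existsP; exists k; rewrite uk ltnW.
  exact: leq_ltn_trans mk (ltn_ord k).
have sumE q : (\sum_(j < r | (j < q)%N) u j = minn r (minn n q))%N.
  by rewrite -sum_ord_ltn; apply: eq_bigr => j _; rewrite uE.
have <- : (\sum_(j < r | (j < r)%N) u j = \sum_(j < r) u j)%N.
  by apply: eq_bigl => j; rewrite ltn_ord.
by rewrite !sumE; lia.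
Qed.

(** * Existence, uniqueness and weight of blocks *)

Section Blocks.
Variables (r : nat) (a : 'I_r -> int).

Notation empty_count := (bead_count (empty_mpart r) a).

Section Multipartition.
Variable lam : multipartition r.

Lemma content_step i :
  (content a lam i)%:Z - (content a lam (i + 1))%:Z =
  (bead_count lam a i)%:Z - (empty_count i)%:Z.
Proof.
rewrite !contentE bead_count_empty /bead_count !posz_sum -!sumrB.
apply: eq_bigr => k _; rewrite beadE subr_lt0.
by rewrite (_ : i - a k + 1 = i + 1 - a k); lia.
Qed.

Lemma fits_content N i : fits a lam N ->
  (i <= - N%:Z) || (N%:Z <= i) -> content a lam i = 0%N.
Proof. by move=> fitN iN; rewrite contentE big1 // => k _; case: (fitN k i iN). Qed.

Lemma fits_empty N : fits a lam N -> fits a (empty_mpart r) N.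
Proof. by move=> fitN k l lN; have [_ ->] := fitN k l lN; rewrite ffunE. Qed.

Lemma bead_chargeN N k : fits a lam N ->
  (\sum_(i <- window N) bead (lam k) (i - a k) = \sum_(i <- window N) (i < a k)%R)%N.
Proof. by move=> fitN; apply/eqP; rewrite -eqz_nat !posz_sum bead_charge. Qed.

Lemma bead_count_sum N : fits a lam N ->
  (\sum_(i <- window N) bead_count lam a i = \sum_(i <- window N) empty_count i)%N.
Proof.
move=> fitN; rewrite exchange_big; under [RHS]eq_bigr do rewrite bead_count_empty.
by rewrite [RHS]exchange_big; apply: eq_bigr => k _; apply: bead_chargeN.
Qed.

End Multipartition.

Lemma empty_count_prefix (s : 'S_r) i p :
  (forall x y : 'I_r, (x <= y)%N -> a (s y) <= a (s x)) ->
  (\sum_(j < r | (j < p)%N) (i < a (s j))%R = minn (empty_count i) p)%N.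
Proof.
move=> s_sort; rewrite bead_count_empty [X in minn X _](reindex_inj (@perm_inj _ s)).
apply: (prefix_sum (u := fun j => i < a (s j))) => x y /s_sort sxy ilt.
exact: lt_le_trans ilt sxy.
Qed.

(** The [p] components of largest charge have [minn (empty_count i) p] beads in
    position [i] when empty, and at most [minn (bead_count i) p] in [lam]; their
    total number of beads is the same. *)
Lemma bead_dominance lam N p : fits a lam N ->
  (\sum_(i <- window N) minn (empty_count i) p <=
   \sum_(i <- window N) minn (bead_count lam a i) p)%N.
Proof.
move=> fitN; have [s s_sort] := sort_charges a.
under eq_bigr do rewrite -(empty_count_prefix _ _ s_sort).
rewrite exchange_big /=; under eq_bigr do rewrite -(bead_chargeN _ fitN).
rewrite exchange_big /=; apply: leq_sum => i _; rewrite leq_min; apply/andP; split.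
  rewrite /bead_count [X in (_ <= X)%N](reindex_inj (@perm_inj _ s)) big_mkcond /=.
  by apply: leq_sum => j _; case: ifP.
apply: (@leq_trans (\sum_(j < r | (j < p)%N) (j < r)%N)).
  by apply: leq_sum => j _; rewrite ltn_ord; case: (bead _ _).
by rewrite sum_ord_ltn; lia.
Qed.

Lemma dsum_of_hub lam theta : hub a lam =1 theta ->
  dsum r theta =1 (fun i => (bead_count lam a i)%:Z).
Proof. by move=> /funext <-; apply: dsum_hub. Qed.

(** The coefficient of [alpha_p] is the sum over [i] of the differences
    [min(d_i, p) - min(D_i, p)], where [D] belongs to the empty
    multipartition; it is nonnegative by dominance. *)
Theorem hub_mapsto lam theta : (1 <= r)%N -> hub a lam =1 theta ->
  mapsto0r (v r (hub a (empty_mpart r))) (v r theta).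
Proof.
move=> r_gt0 hub_lam; have [N fitN'] := fits_exists a lam.
have fitN : fits a lam N by apply: fitN'.
pose m p := (\sum_(i <- window N) minn (bead_count lam a i) p -
             \sum_(i <- window N) minn (empty_count i) p)%N.
have mE p : (m p)%:Z = \sum_(i <- window N)
    ((minn (bead_count lam a i) p)%:Z - (minn (empty_count i) p)%:Z).
  by rewrite sumrB -!posz_sum /m -subzn ?bead_dominance.
exists m; apply/rowP => j.
rewrite (v_diffE _ r_gt0 (dsum_of_hub hub_lam) (dsum_hub a (empty_mpart r))
  (fits_profile fitN) (fits_profile (fits_empty fitN))).
rewrite summxE; under [RHS]eq_bigr do rewrite mulmxnE -mulr_natr natz mE mulr_sumr.
rewrite exchange_big /=.
under [RHS]eq_bigr do under eq_bigr do rewrite mulrBr.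
under [RHS]eq_bigr do rewrite sumrB !alpha_min ?bead_count_le //.
have : \sum_(i <- window N) ((bead_count lam a i)%:Z - (empty_count i)%:Z) = 0.
  by rewrite sumrB -!posz_sum bead_count_sum // subrr.
move: (r.-1 == j)%:R (r == j :> nat)%:R (0%N == j)%:R => x y z sum0.
apply/eqP; rewrite -subr_eq0 -sumrB; apply/eqP.
transitivity (\sum_(i <- window N)
    ((bead_count lam a i)%:Z - (empty_count i)%:Z) * (y - x)); last first.
  by rewrite -mulr_suml sum0 mul0r.
apply: eq_bigr => i _; rewrite !eqz_nat.
rewrite -2!natz.
move: (_ == _)%:R (_ == _)%:R => u w; ring.
Qed.

Lemma content_hub lam mu : content a mu =1 content a lam -> hub a mu =1 hub a lam.
Proof.
move=> c_eq i; rewrite !hubE.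
have d_eq l : (bead_count mu a l)%:Z = (bead_count lam a l)%:Z.
  by have := content_step mu l; have := content_step lam l; rewrite !c_eq; lia.
by rewrite !d_eq.
Qed.

(** The hub gives the bead counts, hence the differences of consecutive entries
    of the content, which vanishes far away. *)
Lemma hub_content lam mu : hub a mu =1 hub a lam -> content a mu =1 content a lam.
Proof.
move=> hub_eq.
have d_eq l : (bead_count mu a l)%:Z = (bead_count lam a l)%:Z.
  by rewrite -(dsum_of_hub hub_eq l) dsum_hub.
have [N1 fit1] := fits_exists a lam; have [N2 fit2] := fits_exists a mu.
pose N := maxn N1 N2.
have c_eq : (fun i => (content a mu i)%:Z) =1 (fun i => (content a lam i)%:Z).
  apply: (@int_diff_unique _ _ (- N%:Z)) => i.
    have := content_step mu (i - 1); have := content_step lam (i - 1).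
    by rewrite !subrK d_eq; lia.
  move=> iN; rewrite (fits_content (fit1 N (leq_maxl _ _))) ?(ltW iN) //.
  by rewrite (fits_content (fit2 N (leq_maxr _ _))) ?(ltW iN).
by move=> i; have [] := c_eq i.
Qed.

Lemma sum_below_charge N (c : int -> int) (x : int) :
  - N%:Z < x <= N%:Z -> c (- N%:Z) = 0 ->
  \sum_(i <- window N) (i < x)%R%:Z * (c i - c (i + 1)) = - c x.
Proof.
(* Summation by parts: [g] telescopes, and [g (i + 1)] vanishes at [i = x - 1]. *)
move=> xN c0; pose g i : int := if i < x then c i - c x else 0.
transitivity (\sum_(i <- window N) (g i - g (i + 1))).
  apply: eq_bigr => i _; rewrite /g.
  have [ix|xi] := ltP i x; last by rewrite (_ : i + 1 < x = false) ?subrr ?mul0r //; lia.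
  rewrite mul1r; have [_|xi] := ltP (i + 1) x; first by ring.
  by rewrite (_ : i + 1 = x) ?subr0 //; lia.
have /andP[Nx xN'] := xN.
by rewrite telescope_window /g Nx ltNge xN' c0 subr0 sub0r.
Qed.

(** Write [D] for the bead counts of the empty multipartition and [c] for the
    content.  The bead counts are [D + delta], with [delta i = c i - c (i + 1)],
    so that their squares differ by [delta^2 + 2 D delta]; and [D] counts the
    charges above [i], so that summation by parts turns the cross term into
    values of [c] at the charges. *)
Lemma sum_sq_content lam N : (0 < N)%N -> fits a lam N ->
  \sum_(i <- window N) ((bead_count lam a i)%:Z ^+ 2 - (empty_count i)%:Z ^+ 2) =
  \sum_(i <- window N) ((content a lam i)%:Z - (content a lam (i + 1))%:Z) ^+ 2
  - 2 * \sum_k (content a lam (a k))%:Z.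
Proof.
move=> N_gt0 fitN; pose c i : int := (content a lam i)%:Z.
have cross : \sum_(i <- window N) (empty_count i)%:Z * (c i - c (i + 1)) = - \sum_k c (a k).
  under eq_bigr do rewrite bead_count_empty posz_sum mulr_suml.
  rewrite exchange_big -sumrN; apply: eq_bigr => k _; apply: sum_below_charge.
    have [|_ e1] := fitN k (- N%:Z); first by rewrite lexx.
    have [|_ e2] := fitN k N%:Z; first by rewrite lexx orbT.
    by lia.
  by rewrite /c (fits_content fitN) // lexx.
rewrite -mulrN -cross mulr_sumr -big_split /=; apply: eq_bigr => i _.
rewrite /c !content_step; ring.
Qed.

Lemma fits_le lam N N' : (N <= N')%N -> fits a lam N -> fits a lam N'.
Proof. by move=> NN' fitN k l lN'; apply: fitN; lia. Qed.

(** The squares in the weight involve [c i - c (i - 1)] instead of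
    [c i - c (i + 1)]; in a window with a margin this shift does not change the
    sum. *)
Lemma weightE lam N : fits a lam N ->
  weight a lam = - 2^-1 *
    (\sum_(i <- window N.+1) ((bead_count lam a i)%:Z ^+ 2 - (empty_count i)%:Z ^+ 2))%:~R.
Proof.
move=> fitN; rewrite (sum_sq_content (ltn0Sn N) (fits_le (leqnSn N) fitN)) /weight.
have c0 i : (i <= - N%:Z) || (N%:Z <= i) -> content a lam i = 0%N by apply: fits_content.
pose F (i : int) : rat := ((content a lam i)%:R - (content a lam (i - 1))%:R) ^+ 2.
have -> : \sum_(i \in [set: int]) F i = \sum_(i <- window N.+1) F i.
  rewrite (fsbigE (window N.+1)) ?window_uniq //.
    by apply: eq_bigl => i; rewrite in_setT.
  by move=> i _; rewrite mem_window => iN; rewrite /F !c0 ?subrr ?expr0n //; lia.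
have -> : \sum_(i <- window N.+1) F i = \sum_(i <- window N.+1) F (i + 1).
  apply/eqP; rewrite -subr_eq0 -sumrB telescope_window /F !c0 ?subrr //; lia.
rewrite rmorphB rmorphM /= 2![in RHS]rmorph_sum /=.
have -> : \sum_k ((content a lam (a k))%:Z)%:~R = \sum_k (content a lam (a k))%:R :> rat.
  by apply: eq_bigr => k _; rewrite pmulrn.
have -> : \sum_(i <- window N.+1)
    (((content a lam i)%:Z - (content a lam (i + 1))%:Z) ^+ 2)%:~R =
    \sum_(i <- window N.+1) F (i + 1) :> rat.
  by apply: eq_bigr => i _; rewrite /F addrK rmorphXn rmorphB /= -sqrrN opprB.
by field.
Qed.

Lemma mapsto_pairing (z : 'rV[int]_r.+1) (m : nat -> nat) (g : nat -> int) :
  z = \sum_(1 <= q < r) alpha r q *+ m q ->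
  \sum_(j < r.+1) g j * z 0 j =
  \sum_(1 <= q < r) (2 * g q - g q.-1 - g q.+1) * (m q)%:Z.
Proof.
move=> ->; under eq_bigr do rewrite summxE mulr_sumr.
rewrite exchange_big /=; apply: eq_big_nat => q qr.
rewrite -(alpha_pairing g qr) mulr_suml; apply: eq_bigr => j _.
by rewrite mulmxnE -mulr_natr natz mulrA.
Qed.

(** The second moment of [v theta - v Theta] computes both sides: it is the sum
    of the [d_i^2 - D_i^2], and each [alpha] contributes [-2] to it. *)
Lemma weight_ht lam theta (r_gt0 : (1 <= r)%N) : hub a lam =1 theta ->
  mapsto0r (v r (hub a (empty_mpart r))) (v r theta) ->
  weight a lam = (ht (v r theta - v r (hub a (empty_mpart r))))%:R.
Proof.
move=> hub_lam [m zE]; have [N fitN'] := fits_exists a lam.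
have fitN := fitN' N (leqnn N); have fitN1 := fitN' N.+1 (leqnSn N).
rewrite (weightE fitN) zE htE.
have := v_diff_pairing (fun j => j%:Z ^+ 2) r_gt0 (dsum_of_hub hub_lam)
  (dsum_hub a (empty_mpart r)) (fits_profile fitN1) (fits_profile (fits_empty fitN1))
  (bead_count_le a lam) (bead_count_le a (empty_mpart r)).
rewrite (mapsto_pairing (fun j => j%:Z ^+ 2) zE) => <-.
have -> : \sum_(1 <= q < r) (2 * q%:Z ^+ 2 - q.-1%:Z ^+ 2 - q.+1%:Z ^+ 2) * (m q)%:Z
   = - 2 * (\sum_(1 <= q < r) m q)%N%:Z.
  rewrite posz_sum mulr_sumr; apply: eq_big_nat => q /andP[q0 _].
  have -> : q.-1%:Z = q%:Z - 1 by lia.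
  have -> : q.+1%:Z = q%:Z + 1 by lia.
  ring.
rewrite rmorphM /= mulrA -pmulrn.
by rewrite rmorphN /= mulrNN mulVf ?mul1r.
Qed.

Lemma big_window N (F : int -> nat) :
  (\sum_(i <- window N) F i = \sum_(n < N + N) F (n%:Z - N%:Z)%R)%N.
Proof. by rewrite big_map -[X in iota _ X]subn0 -/(index_iota _ _) big_mkord. Qed.

(** Gale-Ryser, with a row for each position in the window and a column for each
    runner, provides the beads; the runners are ordered by decreasing charge. *)
Lemma exists_mpart (d : int -> nat) N :
  fits a (empty_mpart r) N -> profile r N (fun i => (d i)%:Z) ->
  (forall i, d i <= r)%N ->
  (\sum_(i <- window N) d i = \sum_(i <- window N) empty_count i)%N ->
  (forall p, (\sum_(i <- window N) minn (empty_count i) p <=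
              \sum_(i <- window N) minn (d i) p)%N) ->
  exists lam, forall i, bead_count lam a i = d i.
Proof.
move=> fitN prof d_le d_sum d_dom; have [s s_sort] := sort_charges a.
pose d' (n : 'I_(N + N)) := d (n%:Z - N%:Z).
pose c (j : 'I_r) := (\sum_(i <- window N) (i < a (s j))%R)%N.
have [||||B [B_row B_col]] := @gale_ryser 'I_(N + N) r d' c.
- move=> x y /s_sort a_xy; apply: leq_sum => i _.
  by case: (ltP i (a (s y))) => // /lt_le_trans/(_ a_xy) ->.
- by move=> n; apply: d_le.
- rewrite /c exchange_big /=; transitivity (\sum_(i <- window N) d i)%N; last by rewrite big_window.
  rewrite d_sum; apply: eq_bigr => i _; rewrite bead_count_empty.
  by rewrite [RHS](reindex_inj (@perm_inj _ s)).
- move=> p; rewrite /c exchange_big /=; under eq_bigr do rewrite (empty_count_prefix _ _ s_sort).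
  by apply: leq_trans (d_dom p) _; rewrite big_window.
(* Below the window every position carries a bead. *)
pose b k (i : int) := (i < - N%:Z) ||
  [exists n : 'I_(N + N), (n%:Z - N%:Z == i) && (n \in B ((s^-1)%g k))].
have b_win k (n : 'I_(N + N)) : b k (n%:Z - N%:Z) = (n \in B ((s^-1)%g k)).
  apply/orP/idP => [[|/existsP[n' /andP[nn' nB]]]|nB]; first by lia.
    by rewrite (_ : n = n') //; apply/val_inj => /=; lia.
  by right; apply/existsP; exists n; rewrite eqxx.
have b_out k i : i \notin window N -> b k i = (i < a k).
  rewrite mem_window => iN; have [|_ ->] := fitN k i; first by lia.
  apply/orP/idP => [[|/existsP[n /andP[/eqP nE _]]]|i0]; first by lia.
    by have := ltn_ord n; lia.
  by left; lia.
have b_sum k : \sum_(i <- window N) ((b k i)%:Z - (i < a k)%R%:Z) = 0.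
  rewrite sumrB -!posz_sum; apply/eqP; rewrite subr_eq0 eqz_nat.
  have -> : (\sum_(i <- window N) (i < a k)%R = c ((s^-1)%g k))%N by rewrite /c permKV.
  apply/eqP; rewrite -B_col -sum1_card [RHS]big_mkcond big_window /=.
  by apply: eq_bigr => n _; rewrite b_win; case: (_ \in _).
have /choice[p pE] : forall k, exists p, forall i, bead p (i - a k) = b k i.
  by move=> k; apply: part_of_beads (b_out k) (b_sum k).
exists [ffun k => p k] => i.
have -> : bead_count [ffun k => p k] a i = (\sum_k b k i)%N.
  by apply: eq_bigr => k _; rewrite ffunE pE.
have [iN|iN] := boolP (i \in window N); last first.
  under eq_bigr do rewrite b_out //; rewrite -bead_count_empty.
  have [dr d0] := prof; have [er e0] := fits_profile fitN.
  move: iN; rewrite mem_window negb_and -!ltNge -leNgt => /orP[] iN.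
    by have := dr i iN; have := er i iN; lia.
  by have := d0 i iN; have := e0 i iN; lia.
have [n ->] : exists n : 'I_(N + N), i = n%:Z - N%:Z.
  move: iN; rewrite mem_window => iN; have nN : (absz (i + N%:Z)%R < N + N)%N by lia.
  by exists (Ordinal nN) => /=; lia.
under eq_bigr do rewrite b_win.
rewrite -[RHS]B_row [LHS](reindex_inj (@perm_inj _ s)).
by apply: eq_bigr => j _; rewrite permK.
Qed.

(** Pairing [v theta - v Theta] with a function [g] on [0, ..., r] gives the sum
    of the [g(d_i) - g(D_i)].  The constant 1 shows that [d] takes its values in
    [0, ..., r], the identity that [d] and [D] have the same sum, and the concave
    functions [min(-, p)] that [d] is dominated as Gale-Ryser requires. *)
Theorem mapsto_hub theta : (1 <= r)%N -> is_hub r theta ->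
  mapsto0r (v r (hub a (empty_mpart r))) (v r theta) ->
  exists lam, hub a lam =1 theta.
Proof.
move=> r_gt0 hub_theta [m zE].
have [N1 prof1] := dsum_profile hub_theta.
have [N2 fit2] := fits_exists a (empty_mpart r).
pose N := maxn N1 N2; have fitN := fit2 N (leq_maxr _ _).
have prof := profile_le (leq_maxl N1 N2) prof1; rewrite -/N in prof.
have eprof := fits_profile fitN; have eE := dsum_hub a (empty_mpart r).
have e_le := bead_count_le a (empty_mpart r).
have d_range : forall i, 0 <= dsum r theta i <= r%:Z.
  apply: (v_diff_sum r_gt0 (fun=> erefl) eE prof eprof e_le).
  under eq_bigr do rewrite -[_ 0 _]mul1r.
  by rewrite (mapsto_pairing (fun=> 1) zE) big1 // => q _; rewrite mulr1 mul0r.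
pose d i := absz (dsum r theta i).
have dE i : dsum r theta i = (d i)%:Z by have := d_range i; rewrite /d; lia.
have d_le i : (d i <= r)%N by have := d_range i; rewrite /d; lia.
have dprof : profile r N (fun i => (d i)%:Z).
  by split=> i iN; rewrite -dE; [apply: prof.1|apply: prof.2].
have pair g : \sum_(i <- window N) (g (d i) - g (empty_count i)) =
    \sum_(1 <= q < r) (2 * g q - g q.-1 - g q.+1) * (m q)%:Z :> int.
  by rewrite -(v_diff_pairing g r_gt0 dE eE dprof eprof d_le e_le) (mapsto_pairing g zE).
have [||lam lamE] := exists_mpart fitN dprof d_le.
- apply/eqP; rewrite -eqz_nat !posz_sum -subr_eq0 -sumrB (pair (fun n => n%:Z)).
  apply/eqP; rewrite big_nat big1 // => q /andP[q0 _].
  by rewrite (_ : _ - _ = 0) ?mul0r //; lia.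
- move=> p; rewrite -lez_nat !posz_sum -subr_ge0 -sumrB (pair (fun n => (minn n p)%:Z)).
  by rewrite big_nat; apply: sumr_ge0 => q /andP[q0 _]; apply: mulr_ge0; lia.
by exists lam => i; rewrite hubE !lamE -!dE dsum_step.
Qed.

End Blocks.

Theorem theorem3p7 (r : nat) (hr : (1 <= r)%N) (a : 'I_r -> int)
    (theta : int -> int) (htheta : is_hub r theta) :
  let Theta := hub a (empty_mpart r) in
  ((exists B : set (multipartition r), is_block a B /\ block_has_hub a B theta)
    <-> mapsto0r (v r Theta) (v r theta))
  /\
  (mapsto0r (v r Theta) (v r theta) ->
    exists B : set (multipartition r),
      unique (fun C => is_block a C /\ block_has_hub a C theta) B /\
      block_has_weight a B (ht (v r theta - v r Theta))%:R).
Proof.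
move=> Theta.
pose block lam := [set mu | content a mu =1 content a lam].
have blockP lam : hub a lam =1 theta ->
    is_block a (block lam) /\ block_has_hub a (block lam) theta.
  move=> hub_lam; split; first by exists lam.
  by move=> mu /content_hub mu_hub i; rewrite mu_hub.
split; first split.
- case=> B [[lam BE] hubB]; apply: (hub_mapsto hr); apply: (hubB lam).
  by rewrite BE.
- by case/(mapsto_hub hr htheta) => lam /blockP; exists (block lam).
move=> z_mapsto; have [lam hub_lam] := mapsto_hub hr htheta z_mapsto.
exists (block lam); split.
  split; first exact: blockP.
  move=> C [[mu CE] hubC].
  have hub_mu : hub a mu =1 hub a lam by move=> i; rewrite hub_lam hubC // CE.
  have c_eq := hub_content hub_mu.
  by rewrite CE; apply/seteqP; split=> nu /= nu_c i; rewrite nu_c c_eq.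
move=> mu /content_hub mu_hub; apply: weight_ht => // i.
by rewrite mu_hub.
Qed.
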